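(* Let $F$ be a commutative field, $n\ge 1$, and let $\nu$ be a quadratic embedding of $\mathrm{PG}(n,F)$ into $\mathrm{PG}(n',F')$. Then $n'=\binom{n+2}{2}-1$.
   Context: $F$ is a commutative field; $F'$ is a field, not assumed to be commutative. $\mathrm{PG}(n,F)=(\mathcal P,\mathcal L)$ and $\mathrm{PG}(n',F')=(\mathcal P',\mathcal L')$ are the projective spaces of (finite) projective dimension $n$, $n'$ over $F$, $F'$, with point sets $\mathcal P,\mathcal P'$ and line sets $\mathcal L,\mathcal L'$. The symbol $\subset$ allows equality. A quadric of $\mathrm{PG}(n,F)$ is the set of zeros in $\mathcal P$ of a non-zero quadratic form on $F^{n+1}$. Let $\Phi=\{\mathcal S\subset\mathcal P \mid \mathcal S \text{ is a quadric of } \mathrm{PG}(n,F)\}\cup\{\mathcal P\}$. For $\mathcal M\subset\mathcal P$ the quadratic closure is $\overline{\overline{\mathcal M}}=\bigcap_{\mathcal M\subset\mathcal S,\ \mathcal S\in\Phi}\mathcal S$. For a set $\mathcal X$ of points of a projective space, $\overline{\mathcal X}$ denotes its linear closure (the smallest subspace containing it). Maps are written as right exponents: $\mathcal M^\nu$ is the image of $\mathcal M$ and $(\cdot)^{\nu^{-1}}$ is the preimage. A map $\nu:\mathcal P\to\mathcal P'$ is a quadratic embedding of $\mathrm{PG}(n,F)$ into $\mathrm{PG}(n',F')$ if $\overline{\overline{\mathcal M}}=(\overline{\mathcal M^\nu})^{\nu^{-1}}$ for all $\mathcal M\subset\mathcal P$, and $\overline{\operatorname{im}\nu}=\mathcal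 P'$. *)

(* Defs.v *)
From mathcomp Require Import all_boot all_algebra.
From mathcomp Require Import boolp classical_sets.

Set Implicit Arguments.
Unset Strict Implicit.
Unset Printing Implicit Defensive.

Import GRing.Theory.
Local Open Scope ring_scope.
Local Open Scope classical_set_scope.

(* The projective space PG(n, K) of the left K-module K^{n+1}. All definitions
   make sense over any ring K; they are meant for K a (possibly
   non-commutative) division ring. *)
Section ProjectiveSpace.
Variables (K : nzRingType) (n : nat).

Definition points : set (set 'rV[K]_n.+1) :=
  [set p | exists2 u : 'rV[K]_n.+1, u != 0 & p = [set a *: u | a in setT]].

(* [points] is coerced to the subtype of its elements, so that
   [val p : set 'rV[K]_n.+1] is the 1-dimensional subspace underlying p. *)
Definition PG : Type := points.

Definition lines : set (set PG) :=
  [set L | exists u v : 'rV[K]_n.+1,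
     (forall a b : K, a *: u + b *: v = 0 -> a = 0 /\ b = 0) /\
     L = [set p : PG |
            val p `<=` [set a *: u + b *: v | a in setT & b in setT]]].

Definition subspaces : set (set PG) :=
  [set S | forall (L : set PG) (p q : PG),
     lines L -> p <> q -> L p -> L q -> S p -> S q -> L `<=` S].

Definition linear_closure (X : set PG) : set PG := smallest subspaces X.

End ProjectiveSpace.

Section Quadrics.
Variables (F : fieldType) (n : nat).

(* Valid in every characteristic. The polar map is symmetric, hence linearity
   in its first argument is bilinearity. *)
Definition quadratic_form (Q : 'rV[F]_n.+1 -> F) : Prop :=
  (forall (a : F) (x : 'rV[F]_n.+1), Q (a *: x) = a ^+ 2 * Q x) /\
  (forall y : 'rV[F]_n.+1, scalar (fun x => Q (x + y) - Q x - Q y)).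

Definition zeros (Q : 'rV[F]_n.+1 -> F) : set (PG F n) :=
  [set p : PG F n | forall x, val p x -> Q x = 0].

Definition quadrics : set (set (PG F n)) :=
  [set S | exists Q : 'rV[F]_n.+1 -> F,
     [/\ quadratic_form Q, exists x, Q x <> 0 & S = zeros Q]].

Definition quadratic_closure (M : set (PG F n)) : set (PG F n) :=
  \bigcap_(S in [set S | (quadrics `|` [set setT]) S /\ M `<=` S]) S.

End Quadrics.

Definition quadratic_embedding (F : fieldType) (F' : nzRingType) (n n' : nat)
    (nu : PG F n -> PG F' n') : Prop :=
  (forall M : set (PG F n),
     quadratic_closure M = nu @^-1` linear_closure (nu @` M)) /\
  linear_closure (range nu) = setT.

(* Main.v *)
(* The quadratic closure and the linear closure pulled back along [nu] agree,
   so a family of points that is independent and spanning for the first is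
   mapped by [nu] to a basis of PG(n', F'). Such a family in PG(n, F) is given
   by the points e_i and e_i + e_j (i < j): only the zero form vanishes on all
   of them, the form x_i x_j isolates e_i + e_j, and the form
   x_i (x_i - \sum_(j != i) x_j) isolates e_i. Counting them gives n' + 1. *)
Require Import Defs.
From mathcomp Require Import all_boot all_algebra.
From mathcomp Require Import boolp classical_sets.
From mathcomp Require Import ring.

Set Implicit Arguments.
Unset Strict Implicit.
Unset Printing Implicit Defensive.

Import GRing.Theory.
Local Open Scope ring_scope.
Local Open Scope classical_set_scope.

(** * Points as spans of non-zero vectors *)

Section Points.
Variables (K : nzRingType) (n : nat).
Implicit Types u v x y : 'rV[K]_n.+1.

Definition point u (u0 : u != 0) : PG K n :=
  SigSub (mem_set (ex_intro2 _ _ u u0 erefl : points [set a *: u | a in setT])).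

Lemma val_point u (u0 : u != 0) : val (point u0) = [set a *: u | a in setT].
Proof. by []. Qed.

Lemma pointP (p : PG K n) : exists u (u0 : u != 0), p = point u0.
Proof.
case: p => p pP; have [u u0 pE] := set_mem pP.
by exists u, u0; apply: val_inj.
Qed.

Lemma mem_point u (u0 : u != 0) : val (point u0) u.
Proof. by exists 1; rewrite ?scale1r. Qed.

End Points.

(** * Linear algebra and subspaces over a division ring *)

Section DivisionRing.
Variables (K : unitRingType).
Hypothesis divK : forall x : K, x != 0 -> x \is a GRing.unit.

(** Gaussian elimination, by induction on the number of columns, with row multipliers on the left
    since [K] need not commute. A zero first column is dropped; otherwise a pivot row [k] clears
    it. *)
Lemma left_kernel_neq0 m n (A : 'M[K]_(m, n)) :
  (n < m)%N -> exists2 u : 'rV_m, u != 0 & u *m A = 0.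
Proof.
elim: n m A => [|n IHn] [|m] A // ltnm.
  exists (const_mx 1); last by apply/rowP => -[].
  by apply/eqP => /rowP/(_ ord0); rewrite !mxE => /eqP; rewrite oner_eq0.
have [A0|/existsNP[k /eqP Ak0]] := pselect (forall i, A i 0 = 0).
  have [u u0 uA] := IHn m.+1 (col' 0 A) (ltnW ltnm).
  exists u => //; apply/rowP => j; rewrite !mxE.
  have [j' ->|->] := unliftP 0 j; last by rewrite big1 // => i _; rewrite A0 mulr0.
  by move/rowP/(_ j'): uA; rewrite !mxE; under eq_bigr do rewrite mxE.
have Aku := divK Ak0.
(* [B] is what remains of the other rows after subtracting multiples of row [k]; [c] is the
   coefficient of row [k] that extends a kernel vector of [B] to one of [A]. *)
pose B := \matrix_(i < m, j < n) (A (lift k i) (lift 0 j)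
  - A (lift k i) 0 * (A k 0)^-1 * A k (lift 0 j)).
have [w w0 wB] := IHn m B ltnm.
pose c := - \sum_i w 0 i * A (lift k i) 0 * (A k 0)^-1.
pose u : 'rV_m.+1 := \row_i if unlift k i is Some i' then w 0 i' else c.
exists u.
  apply: contra_neq w0 => u0; apply/rowP => i.
  by move/rowP/(_ (lift k i)): u0; rewrite !mxE liftK.
apply/rowP => j; rewrite !mxE (bigD1_ord k) //= !mxE unlift_none.
under eq_bigr do rewrite mxE liftK.
rewrite /c mulNr mulr_suml.
have [j' ->|->] := unliftP 0 j.
  move/rowP/(_ j'): wB; rewrite !mxE => wB; rewrite -[RHS]wB addrC -sumrB.
  by apply: eq_bigr => i _; rewrite !mxE mulrBr !mulrA.
rewrite addrC -sumrB big1 // => i _.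
by rewrite mulrVK // subrr.
Qed.

Variable n : nat.
Implicit Types u v x y : 'rV[K]_n.+1.

Lemma eq_pointP u v (u0 : u != 0) (v0 : v != 0) :
  val (point v0) u -> point u0 = point v0.
Proof.
move=> [a _ uE]; apply: val_inj; rewrite !val_point -uE.
have au : a \is a GRing.unit.
  by apply/divK/eqP => a0; move: u0; rewrite -uE a0 scale0r eqxx.
apply/seteqP; split=> _ [b _ <-]; first by exists (b * a); rewrite ?scalerA.
by exists (b * a^-1); rewrite ?scalerA ?mulrVK.
Qed.

Lemma point_free u v (u0 : u != 0) (v0 : v != 0) :
  point u0 <> point v0 -> forall a b, a *: u + b *: v = 0 -> a = 0 /\ b = 0.
Proof.
move=> uv a b abE.
have a0 : a = 0.
  apply: contrapT => /eqP /divK au; apply/uv/eq_pointP.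
  exists (- (a^-1 * b)) => //; rewrite scaleNr -scalerA.
  move/eqP: abE; rewrite addr_eq0 => /eqP abE.
  by rewrite -scalerN -abE scalerA mulVr // scale1r.
split=> //; apply: contrapT => /eqP /divK bu.
move: abE; rewrite a0 scale0r add0r => /(congr1 (fun x => b^-1 *: x)).
by rewrite scalerA mulVr // scale1r scaler0 => /eqP; rewrite (negPf v0).
Qed.

(** Used to bound linear closures from above. Two distinct points of a line have independent
    vectors, so a dependence among three vectors of the line expresses the third through these
    two. *)
Lemma row_span_subspaces m (U : 'M[K]_(m, n.+1)) :
  subspaces [set p : PG K n | val p `<=` range (mulmx^~ U : 'rV_m -> _)].
Proof.
move=> L p q [u [v [_ ->]]] pq /= pL qL pU qU r /= rL.
have [x [x0 pE]] := pointP p; have [y [y0 qE]] := pointP q.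
have [z [z0 rE]] := pointP r; subst p q r.
have [ax _ [bx _ xE]] := pL _ (mem_point x0).
have [ay _ [by_ _ yE]] := qL _ (mem_point y0).
have [az _ [bz _ zE]] := rL _ (mem_point z0).
have [cx _ cxE] := pU _ (mem_point x0).
have [cy _ cyE] := qU _ (mem_point y0).
(* x, y, z lie in the span of the two vectors u, v, hence are dependent *)
pose A : 'M[K]_(3, 2) := \matrix_(i, j)
  nth 0 (nth [::] [:: [:: ax; bx]; [:: ay; by_]; [:: az; bz]] i) j.
have [w w0 wA] := left_kernel_neq0 A isT.
pose a := w 0 0; pose b := w 0 (lift 0 0); pose c := w 0 (lift 0 (lift 0 0)).
have E0 : a * ax + b * ay + c * az = 0.
  by move/rowP/(_ 0): wA; rewrite !mxE !big_ord_recl big_ord0 !mxE addr0 addrA.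
have E1 : a * bx + b * by_ + c * bz = 0.
  by move/rowP/(_ 1): wA; rewrite !mxE !big_ord_recl big_ord0 !mxE addr0 addrA.
have abc0 : a *: x + b *: y + c *: z = 0.
  rewrite -xE -yE -zE !scalerDr !scalerA.
  rewrite [X in X + _]addrACA -(scalerDl u) -(scalerDl v).
  rewrite addrACA -(scalerDl u) -(scalerDl v).
  by rewrite E0 E1 !scale0r addr0.
have c0 : c != 0.
  apply: contra_neq w0 => c0; move: abc0; rewrite c0 scale0r addr0.
  case/(point_free pq) => a0 b0; apply/rowP => i; rewrite mxE.
  have [j ->|->] := unliftP 0 i; last exact: a0.
  have [k ->|->] := unliftP 0 j.
    by rewrite (ord1 k).
  exact: b0.
have zxy : z = - (c^-1 * a) *: x - (c^-1 * b) *: y.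
  have cu := divK c0; rewrite -[LHS]scale1r -(mulVr cu) -(scalerA _ _ z).
  move/eqP: abc0; rewrite addrC addr_eq0 => /eqP ->.
  by rewrite scalerN scalerDr !scalerA opprD scaleNr.
move=> _ [d _ <-]; exists (d *: (- (c^-1 * a) *: cx - (c^-1 * b) *: cy)) => //.
by rewrite -scalemxAl mulmxBl -!scalemxAl cxE cyE -zxy.
Qed.

Lemma linear_closure_sub_row_span m (U : 'M[K]_(m, n.+1)) (X : set (PG K n)) :
  (forall p, X p -> val p `<=` range (mulmx^~ U : 'rV_m -> _)) ->
  forall p, linear_closure X p -> val p `<=` range (mulmx^~ U : 'rV_m -> _).
Proof. by move=> XU; apply: smallest_sub => //; exact: row_span_subspaces. Qed.

(** Two distinct points are joined by a line, which contains the point of [u + v]; if they coincide,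
    [u + v] is a multiple of [u]. *)
Lemma subspacesD (S : set (PG K n)) u v (u0 : u != 0) (v0 : v != 0)
    (uv0 : u + v != 0) :
  subspaces S -> S (point u0) -> S (point v0) -> S (point uv0).
Proof.
move=> subS Su Sv; have [uv|uv] := pselect (point u0 = point v0).
  rewrite (@eq_pointP _ u _ u0) //.
  have [a _ <-] : val (point u0) v by rewrite uv; exact: mem_point.
  by exists (1 + a); rewrite ?scalerDl ?scale1r.
pose L := [set p : PG K n |
  val p `<=` [set a *: u + b *: v | a in setT & b in setT]].
have LL : lines L by exists u, v; split=> //; exact: point_free uv.
apply: (subS L _ _ LL uv _ _ Su Sv) => _ [a _ <-].
- by exists a => //; exists 0; rewrite ?scale0r ?addr0.
- by exists 0 => //; exists a; rewrite ?scale0r ?add0r.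
- by exists a => //; exists a; rewrite ?scalerDr.
Qed.

Lemma subspaces_sum (S : set (PG K n)) (I : Type) (r : seq I) (P : pred I)
    (c : I -> K) (f : I -> 'rV[K]_n.+1) (f0 : forall i, f i != 0) :
  subspaces S -> (forall i, P i -> S (point (f0 i))) ->
  forall s0 : \sum_(i <- r | P i) c i *: f i != 0, S (point s0).
Proof.
move=> subS Sf.
(* A partial sum may vanish and then spans no point, so the property carried through the sum is
   conditional on being non-zero. *)
apply: (big_ind (fun x => forall x0 : x != 0, S (point x0))).
- by move=> x0; case/eqP: (x0).
- move=> x y Sx Sy xy0.
  have [xE|x0] := eqVneq x 0.
    by move: xy0; rewrite xE add0r => y0; exact: Sy.
  have [yE|y0] := eqVneq y 0.
    by move: xy0; rewrite yE addr0 => x0'; exact: Sx.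
  exact: subspacesD xy0 subS (Sx x0) (Sy y0).
move=> i Pi cf0; rewrite (@eq_pointP _ (f i) _ (f0 i)); first exact: Sf.
by exists (c i).
Qed.

(** Too many points have dependent vectors, which puts one point into the closure of the others; the
    vectors of too few points cannot span the whole space. *)
Lemma linear_basis_card m (p : 'I_m -> PG K n) :
  (forall k, ~ linear_closure (p @` [set j | j != k]) (p k)) ->
  linear_closure (range p) = setT -> m = n.+1.
Proof.
move=> p_free p_gen.
have /choice[f fP] : forall i, exists u, exists u0 : u != 0, p i = point u0.
  by move=> i; exact: pointP.
have f0 i : f i != 0 by have [] := fP i.
have {fP} pE i : p i = point (f0 i).
  by have [fi0 ->] := fP i; congr point; exact: bool_irrelevance.
pose U := \matrix_i f i.
have [mn|mn|//] := ltngtP m n.+1; exfalso; last first.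
- have [w w0 wU] := left_kernel_neq0 U mn.
  have /rV0Pn[k wk0] := w0.
  apply: (p_free k) => S [subS XS].
  have wf : \sum_i w 0 i *: f i = 0.
    by rewrite -[RHS]wU mulmx_sum_row; apply: eq_bigr => i _; rewrite rowK.
  have fk : f k = \sum_(i | i != k) (- ((w 0 k)^-1 * w 0 i)) *: f i.
    under eq_bigr do rewrite scaleNr -scalerA.
    rewrite sumrN -scaler_sumr; move/eqP: wf.
    rewrite (bigD1 k) //= addrC addr_eq0 => /eqP ->.
    by rewrite scalerN opprK scalerA mulVr ?scale1r //; exact: divK.
  have s0 := f0 k; rewrite {1}fk in s0.
  rewrite pE (@eq_pointP _ _ _ s0); last by exists 1; rewrite // scale1r -fk.
  by apply: (subspaces_sum (f0 := f0)) => // i ik; rewrite -pE; apply: XS; exists i.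
have gen (u : 'rV_n.+1) : exists w : 'rV_m, w *m U = u.
  have [->|u0] := eqVneq u 0; first by exists 0; rewrite mul0mx.
  have pu : linear_closure (range p) (point u0) by rewrite p_gen.
  have [|w _ <-] := linear_closure_sub_row_span (U := U) _ pu (mem_point u0).
    move=> _ [i _ <-]; rewrite pE => _ [a _ <-].
    by exists (a *: delta_mx 0 i); rewrite // -scalemxAl -rowE rowK.
  by exists w.
(* Generation gives [U] a left inverse with rows [c i]. It has more rows than columns, so a non-zero
   [w] kills it, although [w] times it times [U] is [w]. *)
have /choice[c cE] : forall i, exists w : 'rV_m, w *m U = row i 1%:M by [].
have CU : (\matrix_i c i) *m U = 1%:M.
  by apply/row_matrixP => i; rewrite row_mul rowK cE.
have [w /eqP w0 wC] := left_kernel_neq0 (\matrix_i c i) mn.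
by apply: w0; rewrite -[w]mulmx1 -CU mulmxA wC mul0mx.
Qed.

End DivisionRing.

(** * Quadratic forms and their polar forms *)

Section QuadraticForms.
Variables (F : fieldType) (n : nat) (Q : 'rV[F]_n.+1 -> F).
Hypothesis quadQ : quadratic_form Q.

Let polar x y := Q (x + y) - Q x - Q y.

Let polarC x y : polar x y = polar y x.
Proof. by rewrite /polar [y + x]addrC addrAC. Qed.

Let polar_suml (I : Type) (r : seq I) (c : I -> F) (f : I -> 'rV[F]_n.+1) y :
  polar (\sum_(i <- r) c i *: f i) y = \sum_(i <- r) c i * polar (f i) y.
Proof.
have polarD a u v : polar (a *: u + v) y = a * polar u y + polar v y.
  exact: quadQ.2.
have polar0 : polar 0 y = 0.
  (* The factor [-1] turns the right-hand side into [- polar 0 y + polar 0 y]. *)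
  by have := polarD (-1) 0 0; rewrite scaler0 addr0 mulN1r addNr.
by elim/big_rec2: _ => [//|i x s _ <-]; rewrite polarD.
Qed.

(** The polar form vanishes on pairs of basis vectors, hence everywhere; so [Q] is additive, and it
    is zero on every multiple of a basis vector. *)
Lemma quadratic_form_eq0 :
  (forall i, Q (delta_mx 0 i) = 0) ->
  (forall i j : 'I_n.+1, (i < j)%N -> Q (delta_mx 0 i + delta_mx 0 j) = 0) ->
  forall x, Q x = 0.
Proof.
move=> Qe Qee.
have QZ i a : Q (a *: delta_mx 0 i) = 0 by rewrite quadQ.1 Qe mulr0.
have polar_e i j : polar (delta_mx 0 i) (delta_mx 0 j) = 0.
  rewrite /polar !Qe !subr0; have [ij|ji|/val_inj->] := ltngtP i j.
  - exact: Qee.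
  - by rewrite addrC Qee.
  (* On the diagonal the polar value is [Q] at twice a basis vector, which is zero in every
     characteristic. *)
  - by rewrite -mulr2n -scaler_nat QZ.
have polar_eq0 x y : polar x y = 0.
  rewrite (row_sum_delta x) polar_suml big1 // => i _.
  rewrite polarC (row_sum_delta y) polar_suml big1 ?mulr0 // => j _.
  by rewrite polar_e mulr0.
have QD x y : Q (x + y) = Q x + Q y.
  by apply/eqP; rewrite -subr_eq0 opprD addrA -/(polar x y) polar_eq0.
have Q0 : Q 0 = 0 by rewrite -(scale0r (delta_mx 0 0)) QZ.
move=> x; rewrite (row_sum_delta x).
by elim/big_rec: _ => [//|i y _ Qy]; rewrite QD QZ add0r.
Qed.

End QuadraticForms.

Lemma quadratic_form_mul (F : fieldType) n (f g : 'rV[F]_n.+1 -> F) :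
  scalar f -> scalar g -> quadratic_form (fun x => f x * g x).
Proof.
move=> linf ling.
have linD (h : 'rV[F]_n.+1 -> F) : scalar h -> forall x y, h (x + y) = h x + h y.
  by move=> linh x y; have := linh 1 x y; rewrite scale1r mul1r.
have linZ (h : 'rV[F]_n.+1 -> F) : scalar h -> forall a x, h (a *: x) = a * h x.
  move=> linh a x; have h0 : h 0 = 0.
    by apply: (addrI (h 0)); rewrite -linD // !addr0.
  by have := linh a x 0; rewrite h0 !addr0.
split=> [a x|y a u v]; first by rewrite !linZ //; ring.
by rewrite !linD // !linZ //=; ring.
Qed.

(** * A basis for the quadratic closure *)

Section QuadraticBasis.
Variables (F : fieldType) (n : nat).

(** These pairs index the monomials x_i x_j of degree 2, hence the coefficients of a quadratic
    form. *)
Definition weight2_pair := {ij : 'I_n.+1 * 'I_n.+1 | (ij.1 <= ij.2)%N}.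
Implicit Types s t : weight2_pair.

(* e_i when i = j, and e_i + e_j when i < j *)
Definition weight2_vec t : 'rV[F]_n.+1 :=
  \row_k ((k == (val t).1) || (k == (val t).2))%:R.

Lemma weight2_vec_neq0 t : weight2_vec t != 0.
Proof.
apply/eqP => /rowP/(_ (val t).1); rewrite !mxE eqxx => /eqP.
by rewrite oner_eq0.
Qed.

Definition weight2_point t : PG F n := point (weight2_vec_neq0 t).

Lemma card_weight2_pair : #|{: weight2_pair}| = 'C(n + 2, 2).
Proof.
rewrite card_sig -sum1_card.
rewrite -(pair_big_dep xpredT (fun i j : 'I_n.+1 => (i <= j)%N) (fun _ _ => 1%N)).
(* Each j admits j + 1 values of i; peeling the zero term off 0 + 1 + ... + (n + 1) makes the two
   sums agree term by term. *)
rewrite /= (exchange_big_dep xpredT) //= addn2 -bin2_sum big_mkord big_ord_recl.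
rewrite add0n; apply: eq_bigr => j _.
rewrite -(big_ord_widen n.+1 (fun=> 1%N) (ltn_ord j)) sum1_card card_ord.
by rewrite lift0.
Qed.

Lemma isolating_form s : exists Q : 'rV[F]_n.+1 -> F,
  [/\ quadratic_form Q, Q (weight2_vec s) <> 0
    & forall t, t != s -> Q (weight2_vec t) = 0].
Proof.
case: s => -[i j] /= ij; rewrite /weight2_vec /=.
case: (eqVneq i j) ij => [->|nij] ij.
  exists (fun x => x 0 j * (x 0 j - \sum_(k | k != j) x 0 k)); split.
  - apply: quadratic_form_mul => a u v; first by rewrite !mxE.
    rewrite !mxE mulrBr mulr_sumr addrACA -opprD -big_split /=.
    by congr (_ - _); apply: eq_bigr => k _; rewrite !mxE.
  - rewrite big1 => [|k /negPf kj]; last by rewrite !mxE kj.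
    by rewrite !mxE eqxx subr0 mulr1; apply/eqP/oner_neq0.
  (* Any other vector with coordinate 1 at [j] is e_j + e_m with m distinct from j; its remaining
     coordinates sum to 1, so the second factor vanishes. *)
  - have sum_other m : m != j ->
      \sum_(k | k != j) ((k == j) || (k == m))%:R = 1 :> F.
      move=> mj; rewrite (bigD1 m) //= eqxx orbT big1 ?addr0 // => k.
      by case/andP=> /negPf-> /negPf->.
    case=> -[k l] /= kl ne; rewrite !mxE; under eq_bigr do rewrite mxE.
    have [jk|jk] := eqVneq j k; have [jl|jl] := eqVneq j l.
    + by case/eqP: ne; apply: val_inj; rewrite /= -jk -jl.
    + by rewrite -jk sum_other 1?eq_sym // subrr mulr0.
    + under eq_bigr do rewrite orbC.
      by rewrite -jl sum_other 1?eq_sym // subrr mulr0.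
    + by rewrite mul0r.
exists (fun x => x 0 i * x 0 j); split.
- by apply: quadratic_form_mul => a u v; rewrite !mxE.
- by rewrite !mxE !eqxx orbT mulr1; apply/eqP/oner_neq0.
(* The product is non-zero only if [i] and [j] both lie in {k, l}. As they differ, the pairs agree
   up to a swap, and the swap is excluded by the ordering of both pairs. *)
case=> -[k l] /= kl ne; rewrite !mxE -natrM mulnb; apply/eqP.
rewrite (_ : _ && _ = false) //; apply: contraNF ne => /andP[ikl jkl].
apply/eqP/val_inj => /=.
case/orP: ikl jkl nij ij kl => /eqP-> /orP[] /eqP-> //=; rewrite ?eqxx //.
move=> /eqP nlk lk kl; case: nlk.
by apply/val_inj/anti_leq; rewrite lk.
Qed.

Lemma weight2_point_free s :
  ~ quadratic_closure (weight2_point @` [set t | t != s]) (weight2_point s).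
Proof.
have [Q [quadQ Qs Qt]] := isolating_form s.
move=> /(_ (zeros Q)) sQ; apply/Qs/sQ; last exact: mem_point.
split; first by left; exists Q; split=> //; exists (weight2_vec s).
by move=> _ [t /Qt Qt0 <-] _ [a _ <-]; rewrite quadQ.1 Qt0 mulr0.
Qed.

(** The form of a quadric through all these points would vanish identically, so only the whole space
    enters the intersection. *)
Lemma weight2_point_gen : quadratic_closure (range weight2_point) = setT.
Proof.
apply/seteqP; split=> // q _ S [[[Q [quadQ [x Qx] ->]]|->] //] MQ.
have Qt t : Q (weight2_vec t) = 0 by apply: (MQ (weight2_point t)) => //; exact: mem_point.
case: Qx; apply: (quadratic_form_eq0 quadQ) => [i|i j ij].
  rewrite -[RHS](Qt (exist _ (i, i) (leqnn i))); congr (Q _); apply/rowP => k.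
  by rewrite !mxE orbb.
rewrite -[RHS](Qt (exist _ (i, j) (ltnW ij))); congr (Q _); apply/rowP => k.
rewrite !mxE /=; case: (eqVneq k i) => [->|_]; last by rewrite add0r.
by rewrite [i == j](ltn_eqF ij) addr0.
Qed.

End QuadraticBasis.

(** * Transport of the basis along the embedding *)

Theorem theorem1 (F : fieldType) (F' : unitRingType)
    (division_F' : forall x : F', x != 0 -> x \is a GRing.unit)
    (n n' : nat) (n_ge1 : (1 <= n)%N)
    (nu : PG F n -> PG F' n') (nu_emb : quadratic_embedding nu) :
  n' = ('C(n + 2, 2) - 1)%N.
Proof.
have [nuE nu_gen] := nu_emb.
pose p (k : 'I_#|{: weight2_pair n}|) := weight2_point F (enum_val k).
suff cardE : #|{: weight2_pair n}| = n'.+1.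
  by rewrite -card_weight2_pair cardE subn1.
apply: (linear_basis_card division_F' (p := nu \o p)) => [k nup|].
  (* Freeness: by [nuE], an image in the linear closure of the other images would come from a point
     in the quadratic closure of the other points. *)
  apply: (@weight2_point_free F n (enum_val k)); rewrite nuE => S [subS MS].
  apply: nup; split=> // _ [j jk <-]; apply/MS/imageP.
  by exists (enum_val j) => //=; rewrite (inj_eq enum_val_inj).
(* Generation: by [nuE], a subspace through the images of the basis contains [range nu], because the
   quadratic closure of the basis is everything; and [range nu] spans. *)
apply/seteqP; split=> // q _ S [subS pS].
have : linear_closure (range nu) q by rewrite nu_gen.
apply; split=> // _ [x _ <-].
have : quadratic_closure (range (@weight2_point F n)) x by rewrite weight2_point_gen.
rewrite nuE; apply; split=> // _ [_ [t _ <-] <-].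
by apply: pS; exists (enum_rank t); rewrite //= /p enum_rankK.
Qed.
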